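(* Let $(X,\boldsymbol{f})$ be a topological non-autonomous iterated function system on a compact metric space $(X,d)$ and let $\varphi\in C(X,\mathbb{R})$. Given $Z\subset X$, for any $\alpha\in\mathbb{R}$ and any $\varepsilon,\delta>0$, we have $$M(Z,\boldsymbol{f},\varphi,\alpha+\varepsilon,6\delta,N)\le W(\boldsymbol{f},\varphi,Z,\alpha,\delta,N)\le M(Z,\boldsymbol{f},\varphi,\alpha,\delta,N)$$ for all sufficiently large $N\in\mathbb{N}$. As a result, $$P^{W}_{Z}(\boldsymbol{f},\varphi)=P_{Z}(\boldsymbol{f},\varphi).$$
   Context: A topological non-autonomous iterated function system (NAIFS) $(X,\boldsymbol{f})$ on a compact metric space $(X,d)$ is a sequence $\boldsymbol{f}=\{\boldsymbol{f}^{(j)}\}_{j\ge1}$ of collections $\boldsymbol{f}^{(j)}=\{f_i^{(j)}:X\to X\}_{i\in I^{(j)}}$ of continuous maps, each $I^{(j)}$ being a non-empty finite index set. Here $\mathbb{N}=\{1,2,\dots\}$. For $n\in\mathbb{N}$ put $I^{1,n}=\prod_{j=1}^{n}I^{(j)}$, and for a word $w=w_1\cdots w_n\in I^{1,n}$ and $1\le k\le n$ put $f_w^{1,k}=f^{(k)}_{w_k}\circ\cdots\circ f^{(1)}_{w_1}$, $f_w^{1,0}=\mathrm{id}_X$. Define the metric $d_n(x,y)=\max_{w\in I^{1,n}}\max_{0\le t\le n}d(f_w^{1,t}(x),f_w^{1,t}(y))$ and the Bowen ball $B_n(x,\delta)=\{y\in X:d_n(x,y)<\delta\}$. For $\varphi\in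 C(X,\mathbb{R})$ (continuous real-valued functions on $X$) and $w\in I^{1,n}$ put $S_w\varphi(x)=\sum_{i=0}^{n-1}\varphi(f_w^{1,i}(x))$ and $S_n\varphi(x)=\max_{w\in I^{1,n}}S_w\varphi(x)$. Pesin--Pitskel topological pressure: for $Z\subset X$, $\alpha\in\mathbb{R}$, $\delta>0$, $N\in\mathbb{N}$ let $$M(Z,\boldsymbol{f},\varphi,\alpha,\delta,N)=\inf\Big\{\sum_i\exp\big(-\alpha n_i+S_{n_i}\varphi(x_i)\big)\Big\},$$ the infimum being over all finite or countable families $\{B_{n_i}(x_i,\delta)\}_i$ with $x_i\in X$, $n_i\ge N$ and $Z\subset\bigcup_iB_{n_i}(x_i,\delta)$. This is non-decreasing in $N$; put $m(Z,\boldsymbol{f},\varphi,\alpha,\delta)=\lim_{N\to\infty}M(Z,\boldsymbol{f},\varphi,\alpha,\delta,N)$. Let $$P_Z(\boldsymbol{f},\varphi,\delta)=\inf\{\alpha: m(Z,\boldsymbol{f},\varphi,\alpha,\delta)=0\}=\sup\{\alpha: m(Z,\boldsymbol{f},\varphi,\alpha,\delta)=\infty\}$$ (with $\inf\varnothing=+\infty$, $\sup\varnothing=-\infty$), and $P_Z(\boldsymbol{f},\varphi)=\lim_{\delta\to0}P_Z(\boldsymbol{f},\varphi,\delta)$, which exists in $[-\infty,+\infty]$ by monotonicity in $\delta$. Weighted topological pressure: for $N\in\mathbb{N}$, $\alpha\in\mathbb{R}$, $\delta>0$ and $Z\subset X$ let $$W(\boldsymbol{f},\varphi,Z,\alpha,\delta,N)=\inf\Big\{\sum_ic_i\exp\big(-\alpha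 n_i+S_{n_i}\varphi(x_i)\big)\Big\},$$ the infimum being over all finite or countable families $\{(B_{n_i}(x_i,\delta),c_i)\}_i$ with $0<c_i<\infty$, $x_i\in X$, $n_i\ge N$ for all $i$ and $\sum_ic_i\chi_{B_{n_i}(x_i,\delta)}\ge\chi_Z$, where $\chi_A$ is the characteristic function of $A$. This is non-decreasing in $N$; put $W(\boldsymbol{f},\varphi,Z,\alpha,\delta)=\lim_{N\to\infty}W(\boldsymbol{f},\varphi,Z,\alpha,\delta,N)$, $$P^W_Z(\boldsymbol{f},\varphi,\delta)=\inf\{\alpha:W(\boldsymbol{f},\varphi,Z,\alpha,\delta)=0\}=\sup\{\alpha:W(\boldsymbol{f},\varphi,Z,\alpha,\delta)=\infty\},$$ and $P^W_Z(\boldsymbol{f},\varphi)=\lim_{\delta\to0}P^W_Z(\boldsymbol{f},\varphi,\delta)$ (the limit exists by monotonicity in $\delta$). *)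

(* Defs.v *)
From HB Require Import structures.
From mathcomp Require Import all_boot all_order all_algebra.
From mathcomp Require Import all_classical all_reals all_analysis.

Set Implicit Arguments.
Unset Strict Implicit.
Unset Printing Implicit Defensive.

Import Order.TTheory GRing.Theory Num.Theory.
Import numFieldNormedType.Exports.

Local Open Scope classical_set_scope.
Local Open Scope ring_scope.

(* Times are numbered from 0: [alphabet j] and [step j] stand for I^(j+1) and
   f^(j+1). *)
Record naifs (X : topologicalType) := Naifs {
  alphabet : nat -> finType;
  alphabet_gt0 : forall j, (0 < #|alphabet j|)%N;
  step : forall j, alphabet j -> X -> X;
  step_continuous : forall j (i : alphabet j), continuous (step i)
}.

Section System.
Context {R : realType} {X : metricType R} (f : naifs X).

Definition word (n : nat) := {dffun forall j : 'I_n, alphabet f j}.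

Definition first_word (n : nat) : word n :=
  [ffun j : 'I_n => enum_val (Ordinal (alphabet_gt0 f j))].

(* f_w^{1,t}, for t <= n; the [None] branch is only reached when t > n. *)
Fixpoint iterate (n : nat) (w : word n) (t : nat) : X -> X :=
  if t is s.+1 then
    match insub s : option 'I_n with
    | Some j => step (w j) \o iterate w s
    | None => iterate w s
    end
  else id.

(* Distances are nonnegative, so starting the maxima at 0 is harmless. *)
Definition bowen_dist (n : nat) (x y : X) : R :=
  \big[Num.max/0]_(w : word n) \big[Num.max/0]_(t < n.+1)
    mdist (iterate w t x) (iterate w t y).

Definition bowen_ball (n : nat) (x : X) (delta : R) : set X :=
  [set y | bowen_dist n x y < delta].

Definition birkhoff_sum (phi : X -> R) (n : nat) (w : word n) (x : X) : R :=
  \sum_(i < n) phi (iterate w i x).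

(* R has no least element, so the maximum over words is started at the value
   of one particular word. *)
Definition birkhoff_max (phi : X -> R) (n : nat) (x : X) : R :=
  \big[Num.max/birkhoff_sum phi (first_word n) x]_(w : word n)
    birkhoff_sum phi w x.

Definition bowen_weight (phi : X -> R) (alpha : R) (n : nat) (x : X) : R :=
  expR (- alpha * n%:R + birkhoff_max phi n x).

(* Finite or countable families are the families indexed by a [countType];
   the empty type is allowed, which matters when X is empty. *)
Definition pp_sum (Z : set X) (phi : X -> R) (alpha delta : R) (N : nat) :
    \bar R :=
  ereal_inf [set s | exists (I : countType) (n : I -> nat) (x : I -> X),
    [/\ forall i, (N <= n i)%N,
        Z `<=` \bigcup_i bowen_ball (n i) (x i) delta &
        s = \esum_(i in [set: I]) (bowen_weight phi alpha (n i) (x i))%:E]].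

Definition weighted_sum (Z : set X) (phi : X -> R) (alpha delta : R)
    (N : nat) : \bar R :=
  ereal_inf [set s | exists (I : countType) (n : I -> nat) (x : I -> X)
      (c : I -> R),
    [/\ forall i, 0 < c i,
        forall i, (N <= n i)%N,
        forall z, ((\1_Z z)%:E <=
          \esum_(i in [set: I]) (c i * \1_(bowen_ball (n i) (x i) delta) z)%:E)%E &
        s = \esum_(i in [set: I])
              (c i * bowen_weight phi alpha (n i) (x i))%:E]].

Definition pp_lim (Z : set X) (phi : X -> R) (alpha delta : R) : \bar R :=
  limn (pp_sum Z phi alpha delta).

Definition weighted_lim (Z : set X) (phi : X -> R) (alpha delta : R) : \bar R :=
  limn (weighted_sum Z phi alpha delta).

Definition pp_pressure_at (Z : set X) (phi : X -> R) (delta : R) : \bar R :=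
  ereal_inf [set alpha%:E | alpha in [set alpha | pp_lim Z phi alpha delta = 0%E]].

Definition weighted_pressure_at (Z : set X) (phi : X -> R) (delta : R) : \bar R :=
  ereal_inf
    [set alpha%:E | alpha in [set alpha | weighted_lim Z phi alpha delta = 0%E]].

Definition pp_pressure (Z : set X) (phi : X -> R) : \bar R :=
  lim (pp_pressure_at Z phi delta @[delta --> 0^'+]).

Definition weighted_pressure (Z : set X) (phi : X -> R) : \bar R :=
  lim (weighted_pressure_at Z phi delta @[delta --> 0^'+]).

End System.

(* Main.v *)
Require Import Defs.
From HB Require Import structures.
From mathcomp Require Import all_boot all_order all_algebra finmap.
From mathcomp Require Import all_classical all_reals all_analysis.

Set Implicit Arguments.
Unset Strict Implicit.
Unset Printing Implicit Defensive.

Import Order.TTheory GRing.Theory Num.Theory.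
Import numFieldNormedType.Exports.
Local Open Scope classical_set_scope.
Local Open Scope ring_scope.

(** The inequality W <= M holds because a cover is a weighted cover with all
coefficients 1.

For M <= W, fix a weighted cover (c_i, B_i) of Z, where B_i is the ball of
radius delta around x_i for d_(n_i), and let w_i be the weight of B_i at
exponent alpha. At exponent alpha + epsilon the weight is t_(n_i) w_i with
t_n = exp(- epsilon n), a geometric sequence; for N large its tail from N on
sums to less than 1. A point z of Z receives total mass at least 1 from the
B_i, so for some level n >= N the balls with n_i = n give it mass more than
t_n: z is heavy at level n ([exists_heavy_level]).

At each level n take a maximal set E_n of heavy points at mutual d_n-distance
at least 2 delta ([maximal_separated]). No ball of level n and radius delta
contains two points of E_n, so the families A_(n,y) of indices of balls of
level n containing y, for y in E_n, are disjoint. As A_(n,y) has total mass more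
than t_n, it contains an index i with t_n w_i at most the sum of c_j w_j over
A_(n,y): otherwise a c-weighted average of the w_j would lie below their minimum
([exists_cheap_index]). By disjointness the chosen indices have
total weight at exponent alpha + epsilon at most that of the weighted cover
([esum_disjoint_le]); they form a countable family because they are indices of
the given one. Enlarged to radius 3 delta, the chosen balls cover Z: a heavy
point is within 2 delta of some y in E_n, and y is within delta of the chosen
centre. This is stronger than the radius 6 delta of the statement.

The pressures at a fixed radius are critical exponents of M and W. The
two inequalities give P(6 delta) <= P^W(delta) <= P(delta), after letting
epsilon tend to 0 ([critical_exponent_le_shift]). All these quantities are
nonincreasing in delta, so their limits at 0 are suprema over delta > 0, and a
fixed dilation of delta does not affect a supremum ([lim_at_right0_squeeze]). *)

(** * Bowen distances and separated sets *)

Lemma bowen_distxx (R : realType) (X : metricType R) (f : naifs X) n x :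
  bowen_dist f n x x = 0.
Proof.
apply/eqP; rewrite eq_le; apply/andP; split.
  apply: bigmax_le => // w _; apply: bigmax_le => // t _.
  by rewrite mdistxx.
exact: bigmax_ge_id.
Qed.

Lemma bowen_dist_sym (R : realType) (X : metricType R) (f : naifs X) n x y :
  bowen_dist f n x y = bowen_dist f n y x.
Proof.
by apply: eq_bigr => w _; apply: eq_bigr => t _; rewrite metric_sym.
Qed.

Lemma bowen_dist_triangle (R : realType) (X : metricType R) (f : naifs X)
    n x y z :
  bowen_dist f n x z <= bowen_dist f n x y + bowen_dist f n y z.
Proof.
have ge0 a b : 0 <= bowen_dist f n a b by exact: bigmax_ge_id.
have le_bowen w (t : 'I_n.+1) a b :
    mdist (iterate (f := f) (n := n) w t a) (iterate w t b)
      <= bowen_dist f n a b.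
  apply: le_trans (le_bigmax 0 (fun w' : word f n =>
    \big[Num.max/0]_(t < n.+1) mdist (iterate w' t a) (iterate w' t b)) w).
  exact: (le_bigmax 0 (fun t : 'I_n.+1 => mdist (iterate w t a) (iterate w t b))).
apply: bigmax_le => [|w _]; first exact: addr_ge0.
apply: bigmax_le => [|t _]; first exact: addr_ge0.
by apply: le_trans (metric_triangle _ (iterate w t y) _) _; apply: lerD.
Qed.

(** A separated set that is maximal for inclusion, as given by Zorn's lemma,
is also a net: a point of [D] close to none of its elements could be added. *)
Lemma maximal_separated (T : Type) (close : T -> T -> Prop) (D : set T) :
  (forall x, close x x) -> (forall x y, close x y -> close y x) ->
  exists E : set T, [/\ E `<=` D,
    forall x y, E x -> E y -> close x y -> x = y &
    forall x, D x -> exists2 y, E y & close y x].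
Proof.
move=> refl sym.
pose P (E : set T) := E `<=` D /\ forall x y, E x -> E y -> close x y -> x = y.
have [F FP Ftot|E [[ED Esep] Emax]] := @Zorn_bigcup T P.
  split=> [x [E FE Ex]|x y [E FE Ex] [E' FE' E'y]].
    exact: (FP _ FE).1.
  have [EE'|E'E] := Ftot _ _ FE FE'.
    exact: (FP _ FE').2 (EE' _ Ex) E'y.
  exact: (FP _ FE).2 Ex (E'E _ E'y).
exists E; split=> // x Dx; apply: contrapT => far.
have nEx : ~ E x by move=> Ex; apply: far; exists x.
apply: (Emax (x |` E)).
  split=> [|/(_ x)]; first exact: subsetUr.
  by move=> /(_ (or_introl erefl)).
split=> [y [->|/ED]//|y z [->|Ey] [->|Ez]// yz].
- by case: far; exists z => //; exact: sym.
- by case: far; exists y.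
- exact: Esep.
Qed.

(** * Sums over arbitrary index sets *)

Local Open Scope ereal_scope.

Lemma le_esum_subset (R : realType) (T : choiceType) (A B : set T)
    (a : T -> \bar R) :
  A `<=` B -> (forall i, 0 <= a i) ->
  \esum_(i in A) a i <= \esum_(i in B) a i.
Proof.
move=> AB a0; rewrite esum_mkcond [leRHS]esum_mkcond; apply: le_esum => i _.
case: ifPn => [/set_mem/AB/mem_set -> //|_]; by case: ifPn.
Qed.

Lemma esum_disjoint_le (R : realType) (K T : choiceType) (A : K -> set T)
    (a : T -> \bar R) :
  trivIset [set: K] A -> (forall i, 0 <= a i) ->
  \esum_(k in [set: K]) \esum_(i in A k) a i <= \esum_(i in [set: T]) a i.
Proof.
move=> Adisj a0; rewrite esum_esum//.
(* Disjointness says that forgetting [k] is injective on the pairs (k, i). *)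
rewrite -(@esum_image _ _ _ ([set: K] `*`` A) snd); last first.
  move=> [k i] [k' i'] /set_mem[_ /= Aki] /set_mem[_ /= Aki'] /= ii'.
  congr pair => //; apply: Adisj => //; exists i; split=> //.
  by rewrite ii'.
exact: le_esum_subset.
Qed.

Lemma exists_argmin_seq (R : realType) (T : eqType) (s : seq T) (w : T -> R) :
  s != [::] -> exists2 i, i \in s & forall j, j \in s -> (w i <= w j)%R.
Proof.
elim: s => // a [|b s] IH _.
  by exists a; rewrite ?mem_head// => j; rewrite inE => /eqP ->.
have [//|i si imin] := IH.
have [ai|ia] := leP (w a) (w i).
  exists a; rewrite ?mem_head// => j /[!(in_cons a)] /predU1P[->//|/imin].
  exact: le_trans.
exists i => [|j]; first by rewrite in_cons si orbT.
by rewrite (in_cons a) => /predU1P[->|/imin//]; exact: ltW.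
Qed.

(** Over a finite part of [A] of mass more than [t], the index minimizing [w]
works, since the [c]-weighted sum of [w] is at least the mass times this
minimum. *)
Lemma exists_cheap_index (R : realType) (T : choiceType) (A : set T)
    (c w : T -> R) (t : R) :
  (0 <= t)%R -> (forall i, 0 <= c i)%R -> (forall i, 0 <= w i)%R ->
  t%:E < \esum_(i in A) (c i)%:E ->
  exists2 i, A i & (t * w i)%:E <= \esum_(j in A) (c j * w j)%:E.
Proof.
move=> t0 c0 w0 /ereal_sup_gt[_ [F [finF FA] <-]].
rewrite fsbig_finite//= sumEFin lte_fin => tF.
have [|i Fi imin] := @exists_argmin_seq _ T (fset_set F) w.
  by apply: contraTneq tF => ->; rewrite big_nil -leNgt.
have {}Fi : F i by move: Fi; rewrite in_fset_set// inE.
exists i; first exact: FA.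
apply: esum_ge; exists F => //.
rewrite fsbig_finite//= sumEFin lee_fin.
apply: (@le_trans _ _ (\sum_(j <- fset_set F) c j * w i)%R).
  by rewrite -mulr_suml ler_wpM2r// ltW.
by rewrite big_seq [leRHS]big_seq; apply: ler_sum => j /imin; exact: ler_wpM2l.
Qed.

(** Pigeonhole principle: if every level carried mass at most its threshold
[t n], the mass of [P] would be at most the sum of the thresholds. *)
Lemma exists_heavy_level (R : realType) (T : choiceType) (level : T -> nat)
    (P : set T) (c : T -> R) (t : nat -> R) (N : nat) :
  (forall i, N <= level i)%N -> (forall i, 0 <= c i)%R ->
  \esum_(n in [set n | (N <= n)%N]) (t n)%:E < \esum_(i in P) (c i)%:E ->
  exists n, (t n)%:E < \esum_(i in [set i | level i = n /\ P i]) (c i)%:E.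
Proof.
move=> Nlevel c0; apply: contraPP => /forallNP light; apply/negP.
rewrite -leNgt.
have -> : P = \bigcup_(n in [set n | (N <= n)%N]) [set i | level i = n /\ P i].
  by apply/seteqP; split=> [i Pi|i [n _ []]//]; exists (level i) => //=.
rewrite esum_bigcupT//; last by move=> m n _ _ [i [[<- _] [<- _]]].
by apply: le_esum => n _; rewrite leNgt; apply/negP/light.
Qed.

Lemma esum_geometric_tail_le (R : realType) (q : R) (N : nat) : (0 < q < 1)%R ->
  \esum_(n in [set n | (N <= n)%N]) (q ^+ n)%:E <= (q ^+ N / (1 - q))%:E.
Proof.
move=> /andP[q0 q1].
have q_ge0 n : 0 <= (q ^+ n)%:E by rewrite lee_fin exprn_ge0// ltW.
rewrite -(@nneseries_esum _ _ (leq N))//.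
apply: lime_le; first exact: is_cvg_nneseries_cond.
apply: nearW => m.
have -> : \sum_(0 <= i < m | (N <= i)%N) (q ^+ i)%:E =
    (\sum_(N <= i < m) q ^+ i)%:E.
  by rewrite (big_nat_widenl _ _ _ _ _ (leq0n N)) -sumEFin.
rewrite lee_fin; have [Nm|mN] := leqP N m; last first.
  by rewrite big_geq 1?ltnW// divr_ge0 ?exprn_ge0 ?subr_ge0// ltW.
rewrite -{1}(subnKC Nm) geometric_partial_tail.
apply: geometric_le_lim => //; first by rewrite exprn_ge0// ltW.
by rewrite gtr0_norm.
Qed.

Lemma near_esum_geometric_tail_lt1 (R : realType) (q : R) : (0 < q < 1)%R ->
  \forall N \near \oo, \esum_(n in [set n | (N <= n)%N]) (q ^+ n)%:E < 1.
Proof.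
move=> q01; have /andP[q0 q1] := q01.
have q1' : (`|q| < 1)%R by rewrite gtr0_norm.
have : \forall N \near \oo, (geometric (1 - q)^-1 q N < 1)%R.
  exact: cvgr_lt (cvg_geometric (1 - q)^-1%R q1') _ ltr01.
apply: filterS => N qN; apply: le_lt_trans (esum_geometric_tail_le N q01) _.
by rewrite lte_fin mulrC.
Qed.

Lemma esum_ball_indicator (R : realType) (T : choiceType) (X : Type)
    (B : T -> set X) (c : T -> R) (z : X) :
  \esum_(i in [set: T]) (c i * \1_(B i) z)%:E =
  \esum_(i in [set i | B i z]) (c i)%:E.
Proof.
rewrite [RHS]esum_mkcond; apply: eq_esum => i _.
rewrite indicE; have [Bz|nBz] := pselect (B i z).
  by rewrite !mem_set// mulr1.
by rewrite !memNset// mulr0.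
Qed.

(** * Covers and weighted covers by Bowen balls *)

Section Comparison.
Context {R : realType} {X : metricType R} (f : naifs X).
Context (phi : X -> R).

Lemma bowen_weight_ge0 alpha n x : (0 <= bowen_weight f phi alpha n x)%R.
Proof. exact: expR_ge0. Qed.

Lemma bowen_weightD alpha eps n x :
  bowen_weight f phi (alpha + eps) n x =
  (expR (- eps) ^+ n * bowen_weight f phi alpha n x)%R.
Proof.
by rewrite -expRM_natr -expRD /bowen_weight opprD mulrDl addrAC addrA addrC addrA.
Qed.

(** Allows a cover to be indexed by a subset of a countable type, so that balls
can be selected from a given family. *)
Lemma pp_sum_le_esum (I : countType) (S : set I) (n : I -> nat) (x : I -> X)
    (Z : set X) alpha delta N :
  (forall i, N <= n i)%N ->
  Z `<=` \bigcup_(i in S) bowen_ball f (n i) (x i) delta ->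
  pp_sum f Z phi alpha delta N <=
  \esum_(i in S) (bowen_weight f phi alpha (n i) (x i))%:E.
Proof.
move=> Nn ZS; apply: ereal_inf_lbound.
exists {i : I | i \in S}, (n \o sval), (x \o sval); split=> [i|z /ZS[i Si zi]|].
- exact: Nn.
- by exists (exist _ i (mem_set Si)).
- apply: reindex_esum; split.
  + by move=> [i iS] _ /=; exact: set_mem.
  + by move=> i j _ _ /val_inj.
  + by move=> i Si; exists (exist _ i (mem_set Si)).
Qed.

Lemma weighted_sum_le_pp_sum (Z : set X) alpha delta N :
  weighted_sum f Z phi alpha delta N <= pp_sum f Z phi alpha delta N.
Proof.
apply: ereal_inf_le_tmp => _ [I [n [x [Nn Zcov ->]]]].
exists I, n, x, (fun=> 1%R); split=> // [z|]; last first.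
  by apply: eq_esum => i _; rewrite mul1r.
rewrite esum_ball_indicator indicE; have [Zz|nZz] := pselect (Z z); last first.
  by rewrite memNset//; exact: esum_ge0.
have [i _ zi] := Zcov z Zz; rewrite mem_set//.
rewrite -[leLHS](@esum_set1 R I i (fun=> 1))//.
by apply: le_esum_subset => // _ ->.
Qed.

(** The selection argument: from a weighted cover, extract disjoint families of
indices, one for each point of a maximal separated set of heavy points, and
keep the cheapest ball of each, tripling its radius. *)
Lemma pp_sum_le_weighted_sum (Z : set X) alpha eps delta N : (0 < delta)%R ->
  \esum_(n in [set n | (N <= n)%N]) (expR (- eps) ^+ n)%:E < 1 ->
  pp_sum f Z phi (alpha + eps) (3 * delta) N <=
  weighted_sum f Z phi alpha delta N.
Proof.
move=> delta0 tail1; apply: le_ereal_inf_tmp => _ [I [n [x [c [c0 Nn cov ->]]]]].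
have {}c0 i : (0 <= c i)%R := ltW (c0 i).
pose t k : R := (expR (- eps) ^+ k)%R.
pose w i := bowen_weight f phi alpha (n i) (x i).
pose A (k : nat * X) :=
  [set i | n i = k.1 /\ bowen_ball f (n i) (x i) delta k.2].
pose heavy m :=
  [set z | Z z /\ (t m)%:E < \esum_(i in A (m, z)) (c i)%:E].
pose close m y z := (bowen_dist f m y z < 2 * delta)%R.
have /choice[E Emax] m : exists E : set X, [/\ E `<=` heavy m,
    forall y z, E y -> E z -> close m y z -> y = z &
    forall z, heavy m z -> exists2 y, E y & close m y z].
  apply: maximal_separated => [y|y z].
    by rewrite /close bowen_distxx mulr_gt0.
  by rewrite /close bowen_dist_sym.
pose K := {k : nat * X | k \in [set k | E k.1 k.2]}.
have EK (k : K) : E (val k).1 (val k).2 by exact: set_mem (valP k).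
have /choice[sel selP] (k : K) : exists i, A (val k) i /\
    (t (n i) * w i)%:E <= \esum_(j in A (val k)) (c j * w j)%:E.
  have [Eheavy _ _] := Emax (val k).1.
  have [_] := Eheavy _ (EK k); rewrite -surjective_pairing.
  have t0 : (0 <= t (val k).1)%R by rewrite exprn_ge0// expR_ge0.
  have w0 i : (0 <= w i)%R by exact: bowen_weight_ge0.
  move=> /(exists_cheap_index t0 c0 w0)[i Ai cheap].
  by exists i; split=> //; rewrite Ai.1.
have Adisj : trivIset [set: K] (A \o val).
  move=> k l _ _ [i [[nk ik] [nl il]]]; apply: val_inj.
  have kl1 : (val k).1 = (val l).1 by rewrite -nk.
  have [_ Esep _] := Emax (val k).1.
  rewrite [LHS]surjective_pairing [RHS]surjective_pairing -kl1; congr pair.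
  (* A ball of radius delta around x_i containing both points makes them closer
     than 2 delta. *)
  apply: Esep; [exact: EK|by rewrite kl1; exact: EK|].
  rewrite /close; apply: le_lt_trans (bowen_dist_triangle _ _ _ (x i) _) _.
  rewrite mulr_natl mulr2n bowen_dist_sym.
  by apply: ltrD; rewrite -nk.
have sel_inj : set_inj [set: K] sel.
  move=> k l _ _ kl; apply: Adisj => //; exists (sel k); split.
    exact: (selP k).1.
  by rewrite kl; exact: (selP l).1.
apply: le_trans (pp_sum_le_esum (S := sel @` [set: K]) _ Nn _) _.
  move=> z Zz.
  have [m tm] : exists m, (t m)%:E < \esum_(i in A (m, z)) (c i)%:E.
    apply: (@exists_heavy_level _ _ n [set i | bowen_ball f (n i) (x i) delta z] c t N).
    - exact: Nn.
    - exact: c0.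
    - apply: lt_le_trans tail1 _; have := cov z.
      by rewrite indicE mem_set// esum_ball_indicator.
  have [_ _ /(_ z)[//|y Ey yz]] := Emax m.
  pose k : K := exist _ (m, y) (mem_set Ey).
  exists (sel k); first by exists k.
  have [[nk yk] _] := selP k.
  rewrite /bowen_ball/=; apply: le_lt_trans (bowen_dist_triangle _ _ _ y _) _.
  rewrite !mulr_natl mulrS -mulr_natl.
  by apply: ltrD; [exact: yk|rewrite nk; exact: yz].
rewrite (@esum_image _ _ _ [set: K])//.
apply: (@le_trans _ _ (\esum_(k in [set: K]) \esum_(i in A (val k)) (c i * w i)%:E)).
  by apply: le_esum => k _; rewrite bowen_weightD; exact: (selP k).2.
apply: (@esum_disjoint_le _ K _ (A \o val)) => // i.
by rewrite lee_fin mulr_ge0// bowen_weight_ge0.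
Qed.

Lemma bowen_ball_subset n x d d' : (d <= d')%R ->
  bowen_ball f n x d `<=` bowen_ball f n x d'.
Proof. by move=> dd' y /= /lt_le_trans; apply. Qed.

Lemma pp_sum_ge0 Z alpha delta N : 0 <= pp_sum f Z phi alpha delta N.
Proof.
apply: le_ereal_inf_tmp => _ [I [n [x [_ _ ->]]]].
by apply: esum_ge0 => i _; rewrite lee_fin bowen_weight_ge0.
Qed.

Lemma weighted_sum_ge0 Z alpha delta N : 0 <= weighted_sum f Z phi alpha delta N.
Proof.
apply: le_ereal_inf_tmp => _ [I [n [x [c [c0 _ _ ->]]]]].
by apply: esum_ge0 => i _; rewrite lee_fin mulr_ge0 ?bowen_weight_ge0// ltW.
Qed.

Lemma pp_sum_nondecreasing Z alpha delta :
  {homo pp_sum f Z phi alpha delta : N N' / (N <= N')%N >-> N <= N'}.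
Proof.
move=> N N' NN'; apply: ereal_inf_le_tmp => _ [I [n [x [Nn Zcov ->]]]].
by exists I, n, x; split=> // i; exact: leq_trans (Nn i).
Qed.

Lemma weighted_sum_nondecreasing Z alpha delta :
  {homo weighted_sum f Z phi alpha delta : N N' / (N <= N')%N >-> N <= N'}.
Proof.
move=> N N' NN'; apply: ereal_inf_le_tmp => _ [I [n [x [c [c0 Nn Zcov ->]]]]].
by exists I, n, x, c; split=> // i; exact: leq_trans (Nn i).
Qed.

Lemma pp_sum_radius Z alpha d d' N : (d <= d')%R ->
  pp_sum f Z phi alpha d' N <= pp_sum f Z phi alpha d N.
Proof.
move=> dd'; apply: ereal_inf_le_tmp => _ [I [n [x [Nn Zcov ->]]]].
exists I, n, x; split=> // z /Zcov[i _ zi].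
by exists i => //; exact: bowen_ball_subset zi.
Qed.

Lemma weighted_sum_radius Z alpha d d' N : (d <= d')%R ->
  weighted_sum f Z phi alpha d' N <= weighted_sum f Z phi alpha d N.
Proof.
move=> dd'; apply: ereal_inf_le_tmp => _ [I [n [x [c [c0 Nn Zcov ->]]]]].
exists I, n, x, c; split=> // z; apply: le_trans (Zcov z) _.
rewrite !esum_ball_indicator; apply: le_esum_subset => [i|i].
  exact: bowen_ball_subset.
by rewrite lee_fin ltW.
Qed.

Lemma near_pp_sum_le_weighted_sum Z alpha eps delta :
  (0 < eps)%R -> (0 < delta)%R -> \forall N \near \oo,
    pp_sum f Z phi (alpha + eps) (6 * delta) N <=
    weighted_sum f Z phi alpha delta N.
Proof.
move=> eps0 delta0.
have q01 : (0 < expR (- eps) < 1)%R by rewrite expR_gt0 expR_lt1 oppr_lt0.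
apply: filterS _ (near_esum_geometric_tail_lt1 q01) => N tail1.
apply: le_trans (pp_sum_le_weighted_sum Z alpha delta0 tail1).
by apply: pp_sum_radius; rewrite ler_pM2r// ler_nat.
Qed.

End Comparison.

(** * From covering sums to pressures *)

(** The threshold defining both pressures at a fixed radius. *)
Definition critical_exponent (R : realType) (F : R -> nat -> \bar R) : \bar R :=
  ereal_inf [set alpha%:E | alpha in [set alpha | limn (F alpha) = 0]].

(** If the limit of [G alpha] vanishes then so does that of [F (alpha + e)],
being squeezed between 0 and the former. *)
Lemma critical_exponent_le_shift (R : realType) (F G : R -> nat -> \bar R)
    (e : R) :
  (forall alpha N, 0 <= F alpha N) ->
  (forall alpha, {homo F alpha : N N' / (N <= N')%N >-> N <= N'}) ->
  (forall alpha, {homo G alpha : N N' / (N <= N')%N >-> N <= N'}) ->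
  (forall alpha, \forall N \near \oo, F (alpha + e)%R N <= G alpha N) ->
  critical_exponent F <= critical_exponent G + e%:E.
Proof.
move=> F0 Fnd Gnd FG; rewrite -leeBlDr//.
apply: le_ereal_inf_tmp => _ [alpha /= Galpha <-].
rewrite EFinN leeBlDr// -EFinD; apply: ereal_inf_lbound; exists (alpha + e)%R => //=.
have Fcvg : cvgn (F (alpha + e)%R) by exact: ereal_nondecreasing_is_cvgn.
apply/eqP; rewrite eq_le; apply/andP; split.
  rewrite -Galpha; apply: lee_lim => //.
  exact: ereal_nondecreasing_is_cvgn.
by apply: lime_ge => //; apply: nearW => N.
Qed.

Lemma critical_exponent_le (R : realType) (F G : R -> nat -> \bar R) :
  (forall alpha N, 0 <= F alpha N) ->
  (forall alpha, {homo F alpha : N N' / (N <= N')%N >-> N <= N'}) ->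
  (forall alpha, {homo G alpha : N N' / (N <= N')%N >-> N <= N'}) ->
  (forall alpha N, F alpha N <= G alpha N) ->
  critical_exponent F <= critical_exponent G.
Proof.
move=> F0 Fnd Gnd FG; rewrite -[leRHS]adde0.
apply: critical_exponent_le_shift => // alpha.
by apply: nearW => N; rewrite addr0.
Qed.

(** By monotonicity both limits are suprema over the positive radii, and the
dilation by [a] permutes these radii. *)
Lemma lim_at_right0_squeeze (R : realType) (P Q : R -> \bar R) (a : R) :
  (0 < a)%R ->
  {homo P : d d' / (d <= d')%R >-> d' <= d} ->
  {homo Q : d d' / (d <= d')%R >-> d' <= d} ->
  (forall d, P d <= Q d) ->
  (forall d, (0 < d)%R -> Q (a * d)%R <= P d) ->
  lim (P d @[d --> 0^'+]) = lim (Q d @[d --> 0^'+]).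
Proof.
move=> a0 Pni Qni PQ QP.
have limE (h : R -> \bar R) : {homo h : d d' / (d <= d')%R >-> d' <= d} ->
    lim (h d @[d --> 0^'+]) = ereal_sup (h @` [set` `]0%R, +oo[ ]).
  move=> hni; apply: cvg_lim => //.
  by apply: nonincreasing_at_right_cvge => // x y _ _; exact: hni.
rewrite !limE//; apply/eqP; rewrite eq_le; apply/andP; split.
  apply: ge_ereal_sup => _ [d d0 <-]; apply: le_trans (PQ d) _.
  by apply: ereal_sup_ubound; exists d.
apply: ge_ereal_sup => _ [d /= + <-]; rewrite in_itv/= andbT => d0.
rewrite -(mulVKf (lt0r_neq0 a0) d).
have d'0 : (0 < a^-1 * d)%R by rewrite mulr_gt0// invr_gt0.
apply: le_trans (QP _ d'0) _; apply: ereal_sup_ubound.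
by exists (a^-1 * d)%R => //=; rewrite in_itv/= d'0.
Qed.

Local Close Scope ereal_scope.

Unset Implicit Arguments.

Theorem proposition3p7 (R : realType) (X : metricType R)
    (X_compact : compact [set: X]) (f : naifs X)
    (phi : X -> R) (phi_continuous : continuous phi) (Z : set X) :
  (forall alpha epsilon delta : R, 0 < epsilon -> 0 < delta ->
     \forall N \near \oo,
       (pp_sum f Z phi (alpha + epsilon) (6 * delta) N
          <= weighted_sum f Z phi alpha delta N)%E /\
       (weighted_sum f Z phi alpha delta N
          <= pp_sum f Z phi alpha delta N)%E) /\
  weighted_pressure f Z phi = pp_pressure f Z phi.
Proof.
split=> [alpha eps delta eps0 delta0|].
  apply: filterS (near_pp_sum_le_weighted_sum f phi Z alpha eps0 delta0).
  by move=> N ?; split=> //; exact: weighted_sum_le_pp_sum.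
pose M delta alpha := pp_sum f Z phi alpha delta.
pose W delta alpha := weighted_sum f Z phi alpha delta.
have Mnd d alpha : {homo M d alpha : N N' / (N <= N')%N >-> (N <= N')%E}.
  exact: pp_sum_nondecreasing.
have Wnd d alpha : {homo W d alpha : N N' / (N <= N')%N >-> (N <= N')%E}.
  exact: weighted_sum_nondecreasing.
have M0 d alpha N : (0 <= M d alpha N)%E by exact: pp_sum_ge0.
have W0 d alpha N : (0 <= W d alpha N)%E by exact: weighted_sum_ge0.
apply: (@lim_at_right0_squeeze _ (fun d => critical_exponent (W d))
  (fun d => critical_exponent (M d)) 6) => //.
- move=> d d' dd'; apply: critical_exponent_le => // alpha N.
  exact: weighted_sum_radius.
- by move=> d d' dd'; apply: critical_exponent_le => // alpha N; exact: pp_sum_radius.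
- move=> d; apply: critical_exponent_le => // alpha N.
  exact: weighted_sum_le_pp_sum.
- move=> d d0; apply/lee_addgt0Pr => e e0.
  apply: critical_exponent_le_shift => // alpha.
  exact: near_pp_sum_le_weighted_sum.
Qed.
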